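(* There exist fixed real numbers $0<v_0<v_1$ and a constant $C>0$ such that for every $\epsilon\in(0,1/2]$ there exists a non-collaborative game $\Gamma$ with personal utilities $v_0,v_1$ (in the sense of the context) on at most $C\log(1/\epsilon)$ players, together with a quantum advice for $\Gamma$ that is an equilibrium with guaranteed value, such that $$\frac{CSW(\Gamma)}{QSW(\Gamma)}\le \epsilon ,$$ where $CSW(\Gamma)$ is the best classical social welfare of $\Gamma$ and $QSW(\Gamma)$ is the social welfare obtained when all players follow this quantum advice.
   Context: **Games.** A non-collaborative game $\Gamma$ with personal utilities $v_0<v_1$ on $n$ players consists of: a finite set of types $T\subset\{0,1\}^n$, a probability distribution $w$ on $T$, and a losing set $\mathcal L\subset\{0,1\}^n\times T$. A type $t\in T$ is drawn according to $w$; player $j$ sees only $t_j$ and, without communication, outputs a bit $s_j$ (the strategy). The utility of player $j$ is $$u_j(s|t)=\begin{cases} v_{s_j} & \text{if }(s,t)\notin\mathcal L,\\ 0&\text{otherwise.}\end{cases}$$ The players collectively win when $(s,t)\notin\mathcal L$. The social welfare of a (possibly randomized or correlated) way of playing is the average over the $n$ players of their expected utilities. **Classical advice and CSW.** A local function is a map $f_j:\{0,1\}\to\{0,1\}$ from own type to own output. A classical advice is a probability distribution, independent of the type $t$, on tuples $(f_1,\dots,f_n)$ of local functions; player $j$ is privately told $f_j$. It is a (correlated) equilibrium if no player can increase their expected utility by replacing the recommended $f_j$ by another local function depending on the recommendation, when the others follow theirs. Nash equilibria are the case of product distributions. $CSW(\Gamma)$ is the maximum social welfare over all classical (correlated) equilibria.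 **Quantum advice.** A quantum advice consists of a shared finite-dimensional $n$-partite quantum state, one subsystem per player, and, for every player $j$ and every local type $t_j\in\{0,1\}$, a two-outcome measurement on player $j$'s subsystem; its outcome $a_j\in\{0,1\}$ is the advice to player $j$, and following the advice means outputting $s_j=a_j$. The quantum advice is an equilibrium if no player $j$ can increase their expected utility by outputting $g(t_j,a_j)$ instead of $a_j$, for any function $g:\{0,1\}^2\to\{0,1\}$, when all the other players follow their advice. It has guaranteed value if, for every $t\in T$, when all players follow the advice they win with probability $1$ (so that each player $j$ surely receives the winning payoff $v_{a_j}$). *)

(* Defs.v *)
From HB Require Import structures.
From mathcomp Require Import all_boot all_order all_algebra.
From mathcomp Require Import complex.
From mathcomp Require Import all_classical all_reals all_analysis.

Set Implicit Arguments.
Unset Strict Implicit.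
Unset Printing Implicit Defensive.

Import Order.TTheory GRing.Theory Num.Theory.
Local Open Scope ring_scope.
Local Open Scope complex_scope.
Local Open Scope sesquilinear_scope.

Definition is_distribution (R : realType) (X : finType) (p : X -> R) : Prop :=
  (forall x, 0 <= p x) /\ \sum_x p x = 1.

Definition is_maximum (R : realType) (A : set R) (c : R) : Prop :=
  A c /\ ubound A c.

(* A bit string in {0,1}^n, used both for types and for outputs;
   [false] is 0 and [true] is 1. *)
Definition bits (n : nat) := {ffun 'I_n -> bool}.

(* The prior is a function on all of {0,1}^n that vanishes off the type set.
   At least one player is required, as welfare is an average over players. *)
Record game (R : realType) (n : nat) := Game {
  types : {set bits n};
  prior : bits n -> R;
  losing : {set bits n * bits n};
  players_gt0 : (0 < n)%N;
  prior_distr : is_distribution prior;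
  prior_supp : forall t, t \notin types -> prior t = 0;
  losing_types : forall s t, (s, t) \in losing -> t \in types
}.

Section Utilities.
Variables (R : realType) (v0 v1 : R) (n : nat) (G : game R n).

Definition utility (j : 'I_n) (s t : bits n) : R :=
  if (s, t) \notin losing G then (if s j then v1 else v0) else 0.

(* A way of playing [p] gives the probability [p t s] of the joint output [s]
   on the joint type [t]. *)
Definition expected_utility (p : bits n -> bits n -> R) (j : 'I_n) : R :=
  \sum_t prior G t * \sum_s p t s * utility j s t.

Definition social_welfare (p : bits n -> bits n -> R) : R :=
  (\sum_j expected_utility p j) / n%:R.

End Utilities.

Definition local_fun := {ffun bool -> bool}.

Section Classical.
Variables (R : realType) (v0 v1 : R) (n : nat) (G : game R n).

(* Probability distributions on this type are the classical advices. *)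
Definition advice_tuple := {ffun 'I_n -> local_fun}.

Definition play (F : advice_tuple) (t : bits n) : bits n :=
  [ffun j => F j (t j)].

Definition deviate (j : 'I_n) (phi : local_fun -> local_fun)
    (F : advice_tuple) : advice_tuple :=
  [ffun k => if k == j then phi (F k) else F k].

(* Joint outputs when the tuple drawn from [mu] is transformed by [dev] before
   being played. *)
Definition classical_behaviour (mu : advice_tuple -> R)
    (dev : advice_tuple -> advice_tuple) (t s : bits n) : R :=
  \sum_(F | play (dev F) t == s) mu F.

Definition classical_equilibrium (mu : advice_tuple -> R) : Prop :=
  forall (j : 'I_n) (phi : local_fun -> local_fun),
    expected_utility v0 v1 G (classical_behaviour mu (deviate j phi)) j
    <= expected_utility v0 v1 G (classical_behaviour mu id) j.

Definition classical_equilibrium_welfares : set R :=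
  [set c | exists mu : advice_tuple -> R,
    [/\ is_distribution mu, classical_equilibrium mu &
        c = social_welfare v0 v1 G (classical_behaviour mu id)]].

Definition is_CSW (c : R) : Prop :=
  is_maximum classical_equilibrium_welfares c.

End Classical.

(* The order on [R[i]] makes [0 <= z] entail that z is real, so over the complex
   numbers this condition already forces [A] to be Hermitian. *)
Definition psdmx (R : realType) (m : nat) (A : 'M[R[i]]_m) : Prop :=
  forall v : 'rV[R[i]]_m, 0 <= (v *m A *m v^t*) 0 0.

Section Tensor.
Variables (R : realType) (n : nat) (d : 'I_n -> nat).

(* The product basis of C^(d 0) (x) ... (x) C^(d n.-1): a basis vector of the
   tensor product is a choice of one basis index per factor. *)
Definition joint_index := {dffun forall j : 'I_n, 'I_(d j)}.

Definition tensor_ops (A : forall j : 'I_n, 'M[R[i]]_(d j)) :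
    'M[R[i]]_#|{: joint_index}| :=
  \matrix_(x, y) \prod_j A j ((enum_val x : joint_index) j)
                             ((enum_val y : joint_index) j).

End Tensor.

(* [qmeas j b a] is the effect of outcome [a] in the measurement that player [j]
   performs when their own type is [b]. *)
Record quantum_advice (R : realType) (n : nat) := QuantumAdvice {
  qdim : 'I_n -> nat;
  qstate : 'M[R[i]]_#|{: joint_index qdim}|;
  qmeas : forall j : 'I_n, bool -> bool -> 'M[R[i]]_(qdim j);
  qstate_psd : psdmx qstate;
  qstate_tr : \tr qstate = 1;
  qmeas_psd : forall j b a, psdmx (qmeas j b a);
  qmeas_sum : forall j b, qmeas j b false + qmeas j b true = 1%:M
}.

Section Quantum.
Variables (R : realType) (v0 v1 : R) (n : nat) (G : game R n).
Variable Q : quantum_advice R n.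

Definition born (t a : bits n) : R :=
  complex.Re (\tr (qstate Q *m tensor_ops (fun j => qmeas Q j (t j) (a j)))).

Definition quantum_deviate (j : 'I_n) (g : bool -> bool -> bool)
    (t a : bits n) : bits n :=
  [ffun k => if k == j then g (t k) (a k) else a k].

Definition quantum_deviation (j : 'I_n) (g : bool -> bool -> bool)
    (t s : bits n) : R :=
  \sum_(a | quantum_deviate j g t a == s) born t a.

Definition quantum_equilibrium : Prop :=
  forall (j : 'I_n) (g : bool -> bool -> bool),
    expected_utility v0 v1 G (quantum_deviation j g) j
    <= expected_utility v0 v1 G born j.

Definition guaranteed_value : Prop :=
  forall t, t \in types G -> \sum_(s | (s, t) \notin losing G) born t s = 1.

Definition QSW : R := social_welfare v0 v1 G born.

End Quantum.

(* Main.v *)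
Require Import Defs.
From mathcomp Require Import all_boot all_order all_algebra.
From mathcomp Require Import complex.
From mathcomp Require Import all_classical all_reals all_analysis.
From mathcomp Require Import ring lra.

Set Implicit Arguments.
Unset Strict Implicit.
Unset Printing Implicit Defensive.

Import Order.TTheory GRing.Theory Num.Theory.
Local Open Scope ring_scope.
Local Open Scope sesquilinear_scope.

(* Play k independent copies of the three-player GHZ game on 3k players, and let
   everybody lose as soon as one copy is lost.  Sharing a GHZ state in each copy
   wins with certainty; since the winning condition of a copy is a parity
   condition, any change of a single output loses, so following the advice is an
   equilibrium, and it pays at least v0 to everyone.  Classically a copy is won
   with probability at most 3/4, so no local strategies pay more than
   v1 (3/4)^k.  Always answering 1 attains this bound for every player at once,
   hence is an equilibrium and CSW is exactly v1 (3/4)^k. *)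

(** * Finite sums and products *)

Lemma sum_pushforward (S : nzRingType) (X Y : finType) (mu : X -> S)
    (h : X -> Y) (u : Y -> S) :
  \sum_y (\sum_(x | h x == y) mu x) * u y = \sum_x mu x * u (h x).
Proof.
rewrite [RHS](partition_big h xpredT)//=; apply: eq_bigr => y _.
by rewrite mulr_suml; apply: eq_bigr => x /eqP->.
Qed.

Lemma prod_if0 (S : comNzRingType) (I : finType) (P : pred I) (F : I -> S) :
  \prod_i (if P i then F i else 0) =
  if [forall i, P i] then \prod_i F i else 0.
Proof.
case: ifPn => [/forallP Pall|]; first by apply: eq_bigr => i _; rewrite Pall.
by rewrite negb_forall => /existsP[i /negbTE Pi]; rewrite (bigD1 i)//= Pi mul0r.
Qed.

(** * One copy of the GHZ game *)

(* The bits of the three players of one copy. *)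
Definition triple := (bool * bool * bool)%type.

Definition parity (b : triple) := b.1.1 (+) b.1.2 (+) b.2.

Definition disj (b : triple) := [|| b.1.1, b.1.2 | b.2].

Definition ghz_type (t : triple) := ~~ parity t.

Definition ghz_win (s t : triple) := parity s == disj t.

Lemma sum_triple (S : nzRingType) (F : triple -> S) :
  \sum_b F b = \sum_b0 \sum_b1 \sum_b2 F (b0, b1, b2).
Proof. by rewrite !pair_bigA; apply: eq_bigr => -[[]]. Qed.

(** Winning on all four types is contradictory: each answer [fj b] enters exactly two of the four
    parity conditions, so the left sides add up to 0, whereas [disj] is true on three types. The
    proof enumerates the 64 strategies. *)
Lemma ghz_classical_bound (R : realType) (f0 f1 f2 : bool -> bool) :
  \sum_(t | ghz_type t) (1 / 4) *
     (ghz_win (f0 t.1.1, f1 t.1.2, f2 t.2) t)%:R <= 3 / 4 :> R.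
Proof.
rewrite big_mkcond sum_triple !big_bool /ghz_type /ghz_win /parity /disj /=.
by case: (f0 true); case: (f0 false); case: (f1 true); case: (f1 false);
  case: (f2 true); case: (f2 false) => /=; lra.
Qed.

(** Three ones have odd parity, which loses only on the type 000. *)
Lemma ghz_constant_value (R : realType) :
  \sum_(t | ghz_type t) (1 / 4) * (ghz_win (true, true, true) t)%:R
    = 3 / 4 :> R.
Proof.
by rewrite big_mkcond sum_triple !big_bool /ghz_type /ghz_win /parity /disj /=;
  lra.
Qed.

(** * Splitting 3k players into k copies *)

Section Blocks.
Variable k : nat.

(* [mxvec_index] only serves as a bijection between pairs and ['I_(k * 3)]. *)
Definition player (c : 'I_k) (r : 'I_3) : 'I_(k * 3) := mxvec_index c r.

Lemma player_inj c r c' r' : player c r = player c' r' -> c = c' /\ r = r'.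
Proof.
move=> e; have [g gK _] := curry_mxvec_bij k 3.
have := congr1 g e; rewrite -[player c r]/(uncurry _ (c, r)).
by rewrite -[player c' r']/(uncurry _ (c', r')) !gK ?inE// => -[-> ->].
Qed.

Definition block (x : bits (k * 3)) (c : 'I_k) : triple :=
  (x (player c 0), x (player c 1), x (player c (1 + 1))).

Lemma role_cases (r : 'I_3) : [\/ r = 0, r = 1 | r = 1 + 1].
Proof.
by case: r => -[|[|[|//]]] i; [apply: Or31|apply: Or32|apply: Or33]; apply/val_inj.
Qed.

Lemma big_players (S : Type) (idx : S) (op : Monoid.com_law idx)
    (F : 'I_(k * 3) -> S) :
  \big[op/idx]_j F j = \big[op/idx]_c
     op (op (F (player c 0)) (F (player c 1))) (F (player c (1 + 1))).
Proof.
rewrite (reindex _ (curry_mxvec_bij _ _)) /=.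
transitivity (\big[op/idx]_(p : 'I_k * 'I_3) F (player p.1 p.2)).
  by apply: eq_big => -[].
rewrite -(pair_bigA _ (fun c r => F (player c r))) /=; apply: eq_bigr => c _.
rewrite !big_ord_recl big_ord0 Monoid.mulm1 Monoid.mulmA.
by congr (op (op (F _) (F _)) (F _)); congr player; apply: val_inj.
Qed.

(** A joint bit string is the same as the family of its blocks, so distributivity applies; all
    independence of the copies rests on this. *)
Lemma sum_prod_blocks (S : comNzRingType) (F : 'I_k -> triple -> S) :
  \sum_t \prod_c F c (block t c) = \prod_c \sum_b F c b.
Proof.
rewrite bigA_distr_bigA (reindex (fun t => [ffun c => block t c])) /=.
  by apply: eq_bigr => t _; apply: eq_bigr => c _; rewrite ffunE.
(* Reading off the blocks is injective, and both sides have 8^k elements. *)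
apply/onW_bij/inj_card_bij => [x y /ffunP e|].
  apply/ffunP => j; case/mxvec_indexP: j => c r.
  have := e c; rewrite !ffunE => -[e0 e1 e2].
  by case: (role_cases r) => ->.
by rewrite !card_ffun !card_prod card_bool !card_ord [in X in (_ <= X)%N]mulnC expnM.
Qed.

Definition ghz_types (t : bits (k * 3)) := [forall c, ghz_type (block t c)].

Definition ghz_wins (s t : bits (k * 3)) :=
  [forall c, ghz_win (block s c) (block t c)].

(** Flipping one bit flips the parity of its block, while the parity required there depends on [t]
    alone. *)
Lemma ghz_wins_neq (j : 'I_(k * 3)) (a b t : bits (k * 3)) :
  b j != a j -> (forall l, l != j -> b l = a l) ->
  ghz_wins a t -> ~~ ghz_wins b t.
Proof.
case/mxvec_indexP: j => c r; rewrite -/(player c r) => bj bl /forallP/(_ c) aw.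
apply/negP => /forallP/(_ c); move: aw; rewrite /ghz_win => /eqP <-.
have bl' r' : r' != r -> b (player c r') = a (player c r').
  by move=> rr; apply: bl; apply: contra_neq rr => /player_inj[].
rewrite /parity /=.
case: (role_cases r) bj bl' => -> bj bl'.
- by rewrite (bl' 1)// (bl' (1 + 1))// => /eqP/addIb/addIb; apply/eqP.
- by rewrite (bl' 0)// (bl' (1 + 1))// => /eqP/addIb/addbI; apply/eqP.
- by rewrite (bl' 0)// (bl' 1)// => /eqP/addbI; apply/eqP.
Qed.

(** * The product game and its classical welfare *)

Section Game.
Variable R : realType.

(** The uniform distribution on the 4^k allowed types, written as a product so that it factors over
    the copies. *)
Definition ghz_prior (t : bits (k * 3)) : R :=
  \prod_c if ghz_type (block t c) then 1 / 4 else 0.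

Lemma ghz_prior_distr : is_distribution ghz_prior.
Proof.
split=> [t|]; first by apply: prodr_ge0 => c _; case: ifP => // _; lra.
rewrite (sum_prod_blocks (fun _ b => if ghz_type b then 1 / 4 else 0)).
apply: big1 => c _; rewrite sum_triple !big_bool /ghz_type /parity /=; lra.
Qed.

Lemma ghz_prior_supp t : t \notin [set t | ghz_types t] -> ghz_prior t = 0.
Proof. by rewrite inE /ghz_prior prod_if0 /ghz_types => /negbTE ->. Qed.

Lemma ghz_losing_types s t :
  (s, t) \in [set st | ghz_types st.2 && ~~ ghz_wins st.1 st.2] ->
  t \in [set t | ghz_types t].
Proof. by rewrite !inE => /andP[]. Qed.

Definition ghz_game (k_gt0 : (0 < k * 3)%N) : game R (k * 3) :=
  Game k_gt0 ghz_prior_distr ghz_prior_supp ghz_losing_types.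

Variable k_gt0 : (0 < k * 3)%N.
Let G := ghz_game k_gt0.

Lemma ghz_losingE s t :
  t \in types G -> ((s, t) \in losing G) = ~~ ghz_wins s t.
Proof. by rewrite !inE => ->. Qed.

(** If the output of each copy depends only on the type of that copy, the wins are independent
    events under the product prior. *)
Lemma ghz_win_probability (s : bits (k * 3) -> bits (k * 3))
    (f : 'I_k -> triple -> triple) :
  (forall t c, block (s t) c = f c (block t c)) ->
  \sum_t ghz_prior t * (ghz_wins (s t) t)%:R =
  \prod_c \sum_(b | ghz_type b) (1 / 4) * (ghz_win (f c b) b)%:R.
Proof.
move=> sf.
under [RHS]eq_bigr do rewrite big_mkcond.
rewrite -sum_prod_blocks; apply: eq_bigr => t _.
have -> : (ghz_wins (s t) t)%:R =
    \prod_c (ghz_win (f c (block t c)) (block t c))%:R :> R.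
  rewrite (eq_bigr (fun c => if ghz_win (f c (block t c)) (block t c)
                            then 1 else 0)); last by move=> c _; case: ifP.
  rewrite prod_if0 big1_eq /ghz_wins.
  under eq_forallb do rewrite sf.
  by case: ifP.
rewrite -big_split; apply: eq_bigr => c _ /=.
by case: ifP; rewrite ?mul0r.
Qed.

Lemma ghz_win_probability_le (F : advice_tuple (k * 3)) :
  \sum_t ghz_prior t * (ghz_wins (play F t) t)%:R <= (3 / 4) ^+ k.
Proof.
rewrite (@ghz_win_probability _ (fun c t => (F (player c 0) t.1.1,
    F (player c 1) t.1.2, F (player c (1 + 1)) t.2))); last first.
  by move=> t c; rewrite /block !ffunE.
rewrite -[X in _ ^+ X]card_ord -prodr_const; apply: ler_prod => c _.
rewrite ghz_classical_bound andbT; apply: sumr_ge0 => b _.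
by apply: mulr_ge0; [lra|exact: ler0n].
Qed.

Lemma expected_utility_pushforward (X : finType) (v0 v1 : R)
    (mu : bits (k * 3) -> X -> R)
    (h : bits (k * 3) -> X -> bits (k * 3)) (j : 'I_(k * 3)) :
  expected_utility v0 v1 G (fun t s => \sum_(x | h t x == s) mu t x) j =
  \sum_t prior G t * \sum_x mu t x * utility v0 v1 G j (h t x) t.
Proof. by apply: eq_bigr => t _; rewrite sum_pushforward. Qed.

Variables v0 v1 : R.
Hypotheses (v0_gt0 : 0 < v0) (v01 : v0 < v1).

Lemma expected_utility_classicalE mu dev j :
  expected_utility v0 v1 G (classical_behaviour mu dev) j =
  \sum_F mu F * \sum_t prior G t * utility v0 v1 G j (play (dev F) t) t.
Proof.
rewrite (@expected_utility_pushforward _ _ _ (fun _ => mu)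
  (fun t F => play (dev F) t)).
under eq_bigr do rewrite mulr_sumr.
rewrite exchange_big; apply: eq_bigr => F _; rewrite mulr_sumr.
by apply: eq_bigr => t _; rewrite mulrCA.
Qed.

(** Since [dev] is arbitrary, one bound covers both the deviations from an advice and the advice
    itself. *)
Lemma expected_utility_classical_le mu dev j : is_distribution mu ->
  expected_utility v0 v1 G (classical_behaviour mu dev) j
    <= v1 * (3 / 4) ^+ k.
Proof.
move=> [mu_ge0 mu1]; rewrite expected_utility_classicalE.
rewrite -[leRHS]mul1r -[X in X * (v1 * _)]mu1 mulr_suml; apply: ler_sum => F _.
apply: ler_wpM2l; first exact: mu_ge0.
(* A utility is at most [v1] times the indicator of winning. *)
apply: (le_trans (y := v1 * \sum_t ghz_prior t * (ghz_wins (play (dev F) t) t)%:R)).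
  rewrite mulr_sumr; apply: ler_sum => t _.
  rewrite mulrCA; have [tG|tG] := boolP (t \in types G); last first.
    by rewrite -[prior G t]/(ghz_prior t) ghz_prior_supp// !mul0r.
  apply: ler_wpM2l; first by have [] := ghz_prior_distr.
  rewrite /utility ghz_losingE// negbK.
  by case: ifP => _; rewrite ?mulr0// mulr1; case: ifP => // _; exact: ltW.
by apply: ler_wpM2l; [exact: ltW (lt_trans v0_gt0 v01)|exact: ghz_win_probability_le].
Qed.

Definition all_ones : advice_tuple (k * 3) := [ffun=> [ffun=> true]].

Definition dirac_all_ones (F : advice_tuple (k * 3)) : R := (F == all_ones)%:R.

Lemma dirac_all_ones_distr : is_distribution dirac_all_ones.
Proof.
split=> [F|]; first exact: ler0n.
rewrite (bigD1 all_ones)//= /dirac_all_ones eqxx big1 ?addr0// => F FN.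
by rewrite (negbTE FN).
Qed.

Lemma expected_utility_all_ones j :
  expected_utility v0 v1 G (classical_behaviour dirac_all_ones id) j
    = v1 * (3 / 4) ^+ k.
Proof.
rewrite expected_utility_classicalE (bigD1 all_ones)//= [X in _ + X]big1 ?addr0; last first.
  by move=> F FN; rewrite /dirac_all_ones (negbTE FN) mul0r.
rewrite /dirac_all_ones eqxx mul1r.
transitivity (v1 * \sum_t ghz_prior t * (ghz_wins (play all_ones t) t)%:R).
  rewrite mulr_sumr; apply: eq_bigr => t _.
  rewrite mulrCA; have [tG|tG] := boolP (t \in types G); last first.
    by rewrite ghz_prior_supp// !mul0r.
  rewrite /utility ghz_losingE// negbK !ffunE.
  by case: ifP; rewrite ?mulr1 ?mulr0.
rewrite (@ghz_win_probability _ (fun _ _ => (true, true, true))); last first.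
  by move=> t c; rewrite /block !ffunE.
by under eq_bigr do rewrite ghz_constant_value; rewrite prodr_const card_ord.
Qed.

Lemma average_const (p : bits (k * 3) -> bits (k * 3) -> R) (c : R) :
  (forall j, expected_utility v0 v1 G p j = c) -> social_welfare v0 v1 G p = c.
Proof.
move=> pc; rewrite /social_welfare; under eq_bigr do rewrite pc.
by rewrite sumr_const card_ord -(mulr_natr c) mulfK// pnatr_eq0 -lt0n.
Qed.

Lemma ghz_CSW : is_CSW v0 v1 G (v1 * (3 / 4) ^+ k).
Proof.
split.
  exists dirac_all_ones; split; first exact: dirac_all_ones_distr.
    move=> j phi; rewrite expected_utility_all_ones.
    exact: expected_utility_classical_le dirac_all_ones_distr.
  by rewrite (average_const expected_utility_all_ones).
move=> _ [mu [mu_distr _ ->]].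
rewrite /social_welfare ler_pdivrMr ?ltr0n// mulr_natr.
rewrite -[X in _ *+ X]card_ord -sumr_const; apply: ler_sum => j _.
exact: expected_utility_classical_le.
Qed.

End Game.
End Blocks.

(** * The quantum advice and its outcome probabilities *)

Lemma psdmx_outer (R : realType) m (c : R[i]) (w : 'rV[R[i]]_m) :
  0 <= c -> psdmx (c *: (w^t* *m w)).
Proof.
move=> c_ge0 v; rewrite -scalemxAr -scalemxAl mxE; apply: mulr_ge0 => //.
rewrite mulmxA -(mulmxA (v *m w^t*)) mxE big_ord1.
have -> : (w *m v^t*) 0 0 = ((v *m w^t*) 0 0)^*.
  rewrite !mxE rmorph_sum; apply: eq_bigr => j _.
  by rewrite !mxE rmorphM /= conjCK mulrC.
exact: mul_conjC_ge0.
Qed.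

Section GHZState.
Variables (R : realType) (k : nat).

(** [copy] and [role] are the coordinates of the inverse of [player]. *)
Definition copy (j : 'I_(k * 3)) : 'I_k :=
  (pair_of_mxvec_index (mxvec_indexP j)).1.

Definition role (j : 'I_(k * 3)) : 'I_3 :=
  (pair_of_mxvec_index (mxvec_indexP j)).2.

Lemma player_copy_role j : player (copy j) (role j) = j.
Proof. by rewrite /copy /role; case: (mxvec_indexP j). Qed.

Lemma copy_player c r : copy (player c r) = c.
Proof. by have [] := player_inj (player_copy_role (player c r)). Qed.

Definition qubit (b : bool) : 'I_2 := if b then 1 else 0.

Definition qubits (j : 'I_(k * 3)) := 2%N.

(* The basis vector in which all players of copy [c] share the bit [u c]; the GHZ
   states are the uniform superposition of these. *)
Definition branch (u : {ffun 'I_k -> bool}) : 'I_#|{: joint_index qubits}| :=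
  enum_rank ([ffun j => qubit (u (copy j))] : joint_index qubits).

Lemma branch_inj : injective branch.
Proof.
move=> u v /enum_rank_inj /ffunP e; apply/ffunP => c.
have := e (player c 0); rewrite !ffunE !copy_player.
by case: (u c); case: (v c).
Qed.

Definition ghz_vector : 'rV[R[i]]_#|{: joint_index qubits}| :=
  \sum_u delta_mx 0 (branch u).

Definition ghz_state := 2^-k *: (ghz_vector^t* *m ghz_vector).

Lemma ghz_vector_adj : ghz_vector^t* = \sum_u delta_mx (branch u) 0.
Proof.
rewrite /ghz_vector linear_sum [LHS]raddf_sum; apply: eq_bigr => u _ /=.
by rewrite trmx_delta [LHS]map_delta_mx.
Qed.

(** The expectation of [A] in a pure state only sees the entries of [A] between the branches of the
    superposition. *)
Lemma trace_ghz_state A :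
  \tr (ghz_state *m A) = 2^-k * \sum_u \sum_v A (branch u) (branch v).
Proof.
rewrite -scalemxAl mxtraceZ -mulmxA mxtrace_mulC ghz_vector_adj; congr (_ * _).
rewrite mulmx_suml mulmx_suml raddf_sum; apply: eq_bigr => u _.
rewrite mulmx_sumr raddf_sum; apply: eq_bigr => v _ /=.
by rewrite -rowE -colE /mxtrace big_ord1 !mxE.
Qed.

Lemma ghz_state_tr : \tr ghz_state = 1.
Proof.
rewrite -[ghz_state]mulmx1 trace_ghz_state.
rewrite (eq_bigr (fun=> 1)) => [|u _].
  rewrite sumr_const card_ffun card_bool card_ord natrX mulVf// expf_neq0// pnatr_eq0.
rewrite (bigD1 u)//= mxE eqxx big1 ?addr0// => v vu.
by rewrite mxE (inj_eq branch_inj) eq_sym (negbTE vu).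
Qed.

Lemma ghz_state_psd : psdmx ghz_state.
Proof. by apply: psdmx_outer; rewrite invr_ge0 exprn_ge0. Qed.

Definition phase (b a : bool) : R[i] := (-1) ^+ a * 'i ^+ b.

(* The conjugate transposes are, up to normalisation, the eigenvectors of Pauli X
   for type 0 and of Pauli Y for type 1. *)
Definition effect_vector (b a : bool) : 'rV[R[i]]_2 :=
  \row_x (phase b a) ^+ x.

Definition ghz_effect (b a : bool) : 'M[R[i]]_2 :=
  2^-1 *: ((effect_vector b a)^t* *m effect_vector b a).

Lemma ghz_effectE b a p q :
  ghz_effect b a (qubit p) (qubit q) =
  2^-1 * ((if p then phase b a else 1)^* * (if q then phase b a else 1)).
Proof.
rewrite /ghz_effect !mxE big_ord1 !mxE.
by congr (_ * (_^* * _)); [case: p|case: q]; rewrite ?expr0 ?expr1.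
Qed.

Lemma ghz_effect_psd b a : psdmx (ghz_effect b a).
Proof. by apply: psdmx_outer; rewrite invr_ge0. Qed.

Lemma phase_unit b a : (phase b a)^* * phase b a = 1.
Proof.
rewrite /phase rmorphM rmorph_sign rmorphXn /= conjCi mulrACA -expr2 sqrr_sign.
by rewrite -exprMn mulNr mulCii opprK expr1n mulr1.
Qed.

(** The two outcomes have opposite phases, so the off-diagonal entries cancel; the phases are
    unimodular, so each diagonal entry is 1/2 + 1/2. *)
Lemma ghz_effect_sum b : ghz_effect b false + ghz_effect b true = 1%:M.
Proof.
have qubitK (x : 'I_2) : x = qubit (x == 1).
  by case: x => -[|[|//]] i; apply: val_inj.
have phaseN : phase b true = - phase b false.
  by rewrite /phase expr0 expr1 mul1r mulN1r.
apply/matrixP => x y; rewrite (qubitK x) (qubitK y) [LHS]mxE [RHS]mxE.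
rewrite !ghz_effectE phaseN; have := phase_unit b false.
by case: (x == 1); case: (y == 1); rewrite ?rmorph1 ?rmorphN /=;
  move: (phase _ _) => z zz; field: zz.
Qed.

Definition ghz_advice : quantum_advice R (k * 3) :=
  @QuantumAdvice R (k * 3) qubits ghz_state (fun=> ghz_effect)
    ghz_state_psd ghz_state_tr (fun=> ghz_effect_psd) (fun=> ghz_effect_sum).

(** The product is (-1)^(parity of [a]) times i^(number of ones in [t]). That number is 0 or 2, so
    the power of i is -1 exactly when [disj t] holds. *)
Lemma phase_product (a t : triple) : ghz_type t ->
  phase t.1.1 a.1.1 * phase t.1.2 a.1.2 * phase t.2 a.2 =
  (-1) ^+ (~~ ghz_win a t).
Proof.
have ii : 'i * 'i = -1 :> R[i] by rewrite mulCii.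
case: t => -[[] []] [] //; case: a => -[[] []] [] _;
  rewrite /phase /= ?expr0 ?expr1; ring: ii.
Qed.

Lemma ghz_born_copy (a t : triple) : ghz_type t ->
  \sum_p \sum_q ghz_effect t.1.1 a.1.1 (qubit p) (qubit q) *
     ghz_effect t.1.2 a.1.2 (qubit p) (qubit q) *
     ghz_effect t.2 a.2 (qubit p) (qubit q) =
  if ghz_win a t then 2^-1 else 0.
Proof.
move=> tP.
under eq_bigr do under eq_bigr do rewrite !ghz_effectE.
rewrite !big_bool rmorph1.
have := phase_product a tP; move: (ghz_win a t) => w.
move: (phase _ _) (phase _ _) (phase _ _) => z2 z1 z0 zE.
have zcE : z0^* * z1^* * z2^* = (-1) ^+ ~~ w.
  by rewrite -!rmorphM zE rmorph_sign.
(* The interference of the branches 000 and 111: [|1 + z0 z1 z2|^2 / 8] *)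
transitivity (8^-1 * ((1 + z0^* * z1^* * z2^*) * (1 + z0 * z1 * z2))).
  by rewrite /=; field.
by rewrite zE zcE; case: w {zE zcE} => /=; field.
Qed.

(** State and effects factor over the copies. A won copy contributes 1/2 from [ghz_born_copy] and
    1/2 from the normalisation of the state. *)
Lemma ghz_born t a : ghz_types t ->
  born ghz_advice t a = if ghz_wins a t then (1 / 4) ^+ k else 0.
Proof.
move=> tP; rewrite /born trace_ghz_state.
pose H c p q := ghz_effect (block t c).1.1 (block a c).1.1 (qubit p) (qubit q) *
  ghz_effect (block t c).1.2 (block a c).1.2 (qubit p) (qubit q) *
  ghz_effect (block t c).2 (block a c).2 (qubit p) (qubit q).
have -> : \sum_u \sum_v tensor_ops (fun j => qmeas ghz_advice j (t j) (a j))
      (branch u) (branch v) = \prod_c \sum_p \sum_q H c p q.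
  rewrite bigA_distr_bigA; apply: eq_bigr => u _.
  rewrite bigA_distr_bigA; apply: eq_bigr => v _.
  rewrite mxE !enum_rankK big_players; apply: eq_bigr => c _.
  by rewrite !ffunE !copy_player.
rewrite -[k in 2^-k]card_ord -exprVn -prodr_const -big_split /=.
(* Each factor is written as an embedded real, so that the real part of the product can be read
   off. *)
rewrite (eq_bigr (fun c => (if ghz_win (block a c) (block t c)
                           then 1 / 4 else 0 : R)%:C%C)); last first.
  move=> c _; rewrite ghz_born_copy; last exact: (forallP tP).
  case: ifP => _; rewrite ?mulr0// mul1r fmorphV rmorph_nat.
  by field.
by rewrite -rmorph_prod /= prod_if0 prodr_const card_ord.
Qed.

(** * Equilibrium and welfare of the quantum advice *)

Variables (k_gt0 : (0 < k * 3)%N) (v0 v1 : R).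
Hypotheses (v0_gt0 : 0 < v0) (v01 : v0 < v1).
Let G := ghz_game R k_gt0.

Lemma ghz_born_ge0 t a : t \in types G -> 0 <= born ghz_advice t a.
Proof.
by rewrite inE => tG; rewrite ghz_born//; case: ifP.
Qed.

Lemma ghz_born_sum t : t \in types G -> \sum_a born ghz_advice t a = 1.
Proof.
rewrite inE => tG.
transitivity (\sum_a \prod_c
    (if ghz_win (block a c) (block t c) then 1 / 4 else 0 : R)).
  by apply: eq_bigr => a _; rewrite ghz_born// prod_if0 prodr_const card_ord.
rewrite (sum_prod_blocks (fun c b => if ghz_win b (block t c) then 1 / 4 else 0)).
(* Four of the eight outputs of a copy have the required parity. *)
apply: big1 => c _; rewrite sum_triple !big_bool /ghz_win /parity /=.
by case: (disj _) => /=; lra.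
Qed.

Lemma ghz_guaranteed_value : guaranteed_value G ghz_advice.
Proof.
move=> t tG; rewrite -[RHS](ghz_born_sum tG) big_mkcond; apply: eq_bigr => a _.
rewrite ghz_losingE// negbK; case: ifPn => // aL.
by rewrite ghz_born ?(negbTE aL)//; move: tG; rewrite inE.
Qed.

(** The comparison holds for each type and each advice separately: a losing advice has probability
    0, and a winning one is either left unchanged or turned into a loss. *)
Lemma ghz_quantum_equilibrium : quantum_equilibrium v0 v1 G ghz_advice.
Proof.
move=> j g; rewrite expected_utility_pushforward; apply: ler_sum => t _.
have [tG|tG] := boolP (t \in types G); last first.
  by rewrite -[prior G t]/(ghz_prior R t) ghz_prior_supp// !mul0r.
apply: ler_wpM2l; first exact: (ghz_prior_distr k R).1.
apply: ler_sum => a _; have [aw|aL] := boolP (ghz_wins a t); last first.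
  rewrite ghz_born ?(negbTE aL) ?mul0r//; by move: tG; rewrite inE.
apply: ler_wpM2l; first exact: ghz_born_ge0.
set b := quantum_deviate j g t a.
have bl l : l != j -> b l = a l by move=> lj; rewrite ffunE (negbTE lj).
have [bj|bj] := eqVneq (b j) (a j).
  suff -> : b = a by [].
  by apply/ffunP => l; have [->//|/bl] := eqVneq l j.
rewrite {1}/utility ghz_losingE// negbK (negbTE (ghz_wins_neq bj bl aw)).
rewrite /utility; case: ifP => // _; case: ifP => _; last exact: ltW.
exact: ltW (lt_trans v0_gt0 v01).
Qed.

Lemma ghz_QSW_ge : v0 <= QSW v0 v1 G ghz_advice.
Proof.
rewrite /QSW /social_welfare ler_pdivlMr ?ltr0n// mulr_natr.
rewrite -[X in _ *+ X]card_ord -sumr_const; apply: ler_sum => j _.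
have [prior_ge0 prior1] := ghz_prior_distr k R.
rewrite -[leLHS]mul1r -[X in X * v0]prior1 mulr_suml; apply: ler_sum => t _.
have [tG|tG] := boolP (t \in types G); last first.
  by rewrite -[prior G t]/(ghz_prior R t) ghz_prior_supp// !mul0r.
apply: ler_wpM2l; first exact: prior_ge0.
rewrite -[leLHS]mul1r -[X in X * v0](ghz_born_sum tG) mulr_suml.
apply: ler_sum => a _; have [aw|aL] := boolP (ghz_wins a t); last first.
  rewrite ghz_born ?(negbTE aL) ?mul0r//; by move: tG; rewrite inE.
apply: ler_wpM2l; first exact: ghz_born_ge0.
by rewrite /utility ghz_losingE// negbK aw; case: ifP => // _; exact: ltW.
Qed.

End GHZState.

(** * The number of copies *)

Lemma amplification_exponent (R : realType) (eps : R) : 0 < eps -> eps <= 1 / 2 ->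
  exists2 k : nat, (0 < k)%N &
    2 * (3 / 4) ^+ k <= eps /\
    (k * 3)%:R <= 3 * (2 / ln (4 / 3) + 1 / ln 2) * ln (1 / eps).
Proof.
move=> e0 e1; pose L := ln (1 / eps).
have l43 : 0 < ln (4 / 3) :> R by apply: ln_gt0; lra.
have l2 : 0 < ln 2 :> R by apply: ln_gt0; lra.
have eV : 2 <= 1 / eps by rewrite ler_pdivlMr//; lra.
have L2 : ln 2 <= L by rewrite ler_ln// posrE; lra.
(* This is the real solution of 2 (3/4)^x = eps; the number of copies is the integer part of [x]
   plus one. *)
pose x := (ln 2 + L) / ln (4 / 3).
have x0 : 0 <= x by apply: divr_ge0; lra.
have /andP[] := truncn_itv x0; move: (Num.truncn x) => m mx xm.
exists m.+1 => //; split.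
  have : ln (2 * (1 / eps)) <= ln ((4 / 3) ^+ m.+1).
    rewrite lnXn; last by lra.
    rewrite lnM ?posrE; [|lra..].
    by rewrite -[leRHS]mulr_natl -ler_pdivrMr//; exact: ltW.
  rewrite ler_ln ?posrE ?exprn_gt0//; [|lra..].
  move=> h; have q0 : 0 < (4 / 3 : R) ^+ m.+1 by apply: exprn_gt0; lra.
  have -> : (3 / 4 : R) = (4 / 3)^-1 by rewrite invf_div.
  rewrite exprVn (ler_pdivrMr _ _ q0).
  by move: h; rewrite mul1r (ler_pdivrMr _ _ e0) mulrC.
(* As eps is at most 1/2, [ln 2 <= L]: this gives [x <= 2 * L / ln (4 / 3)] and absorbs the extra
   copy into [L / ln 2]. *)
rewrite natrM mulrC -mulrA ler_pM2l// mulrDl -natr1; apply: lerD.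
  apply: (le_trans mx); rewrite /x -/L [leRHS]mulrAC ler_pM2r ?invr_gt0//; lra.
by rewrite -/L mul1r mulrC ler_pdivlMr// mul1r.
Qed.

Theorem theorem3 (R : realType) :
  exists v0 v1 C : R,
    [/\ 0 < v0, v0 < v1, 0 < C &
      forall eps : R, 0 < eps -> eps <= 1 / 2 ->
        exists (n : nat) (G : game R n) (Q : quantum_advice R n) (CSW : R),
          [/\ n%:R <= C * ln (1 / eps),
              quantum_equilibrium v0 v1 G Q,
              guaranteed_value G Q,
              is_CSW v0 v1 G CSW &
              CSW / QSW v0 v1 G Q <= eps]].
Proof.
have v0_gt0 : 0 < 1 :> R by [].
have v01 : 1 < 2 :> R by lra.
(* With [v0 = 1] the quantum welfare is at least 1, so the ratio is at most the classical welfare;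
   [v1 = 2] is the factor 2 in [amplification_exponent]. *)
exists 1, 2, (3 * (2 / ln (4 / 3) + 1 / ln 2)); split=> //.
  by rewrite mulr_gt0// addr_gt0// divr_gt0// ln_gt0//; lra.
move=> eps eps_gt0 /(amplification_exponent eps_gt0)[k k_gt0 [k_large k_small]].
have players : (0 < k * 3)%N by rewrite muln_gt0 k_gt0.
have QSW_ge1 := ghz_QSW_ge players v01.
exists (k * 3)%N, (ghz_game R players), (ghz_advice R k), (2 * (3 / 4) ^+ k).
split=> //; [exact: ghz_quantum_equilibrium|exact: ghz_guaranteed_value|
  exact: ghz_CSW|].
rewrite ler_pdivrMr ?(lt_le_trans v0_gt0)//; apply: (le_trans k_large).
by rewrite ler_peMr// ltW.
Qed.
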